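(* Let the spectral density $g(\lambda,\omega)$, $\lambda\in\mathbb{R}^d$, $\omega\in\mathbb{R}$, of a covariance function $K$ have the form $g(\lambda,\omega)=p(\omega)q(\lambda,\omega)$. The following two statements hold: (i) If $g$ and $q$ both satisfy the flattening condition on $\mathbb{R}^d\times\mathbb{R}$, then $p$ must be constant in $\omega$. (ii) If $g$ satisfies the flattening condition on $\mathbb{R}^d\times\mathbb{R}$, then for every point $\omega_0$ such that $p(\omega_0)$ is finite and positive, the marginal spectrum $g^*_{\omega_0}(\lambda)=g(\lambda,\omega_0)$ must satisfy the flattening condition as a function of $\lambda\in\mathbb{R}^d$.
   Context: Flattening condition on $\mathbb{R}^d\times\mathbb{R}$: a function $g$ of $(\lambda,\omega)\in\mathbb{R}^d\times\mathbb{R}$ satisfies it if for every finite $R>0$, $$\lim_{\|(\lambda,\omega)\|\to\infty}\ \sup_{\|(u,v)\|<R}\left|\frac{g(\lambda+v,\omega+u)}{g(\lambda,\omega)}-1\right|=0,$$ where $v\in\mathbb{R}^d$, $u\in\mathbb{R}$, and the limit is along any path to infinity (in particular either $\lambda$ or $\omega$ may stay bounded or fixed while the other diverges). Flattening condition for a function $g^*$ of $\lambda\in\mathbb{R}^d$ alone: for every finite $R>0$, $$\lim_{\|\lambda\|\to\infty}\ \sup_{\|v\|<R}\left|\frac{g^*(\lambda+v)}{g^*(\lambda)}-1\right|=0 .$$ Spectral density: for a stationary, continuous space-time covariance function $K(s,t)$, $s\in\mathbb{R}^d$, $t\in\mathbb{R}$, it is the non-negative integrable function $g$ with $$K(s,t)=\frac{1}{(2\pi)^{d+1}}\int_{\mathbb{R}}\int_{\mathbb{R}^d}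 g(\lambda,\omega)\exp(i s^T\lambda+it\omega)\,d\lambda\,d\omega .$$ *)

(* Defs.v *)
From HB Require Import structures.
From mathcomp Require Import all_boot all_order all_algebra.
From mathcomp Require Import complex.
From mathcomp Require Import all_classical all_reals all_analysis.

Set Implicit Arguments.
Unset Strict Implicit.
Unset Printing Implicit Defensive.

Import Order.TTheory GRing.Theory Num.Theory.
Import numFieldNormedType.Exports.

Local Open Scope classical_set_scope.
Local Open Scope ring_scope.

(* Euclidean norms: the canonical norm on row vectors and on pairs is the sup
   norm. *)
Definition enorm (R : realType) (d : nat) (v : 'rV[R]_d) : R :=
  Num.sqrt (\sum_(i < d) v ord0 i ^+ 2).

Definition st_norm (R : realType) (d : nat) (x : 'rV[R]_d * R) : R :=
  Num.sqrt (\sum_(i < d) x.1 ord0 i ^+ 2 + x.2 ^+ 2).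

(* The filter of the sets containing {x | M < N x} for some real M: a limit
   along it is a limit as N x tends to infinity, along any path. *)
Definition at_infinity (R : realType) (V : Type) (N : V -> R) : set_system V :=
  filter_from [set: R] (fun M => [set x | M < N x]).

(* The functions take values in the extended reals, so that a density (or one
   of its factors) may be infinite at some points.  The conventions of \bar R
   for the meaningless quotients are harmless: for h = 0 the expression
   `|g x / g x - 1| is at least 1 as soon as g x is 0 or infinite. *)
Definition flattening (R : realType) (V : zmodType) (N : V -> R)
    (g : V -> \bar R) : Prop :=
  forall r : R, 0 < r ->
    (fun x => ereal_sup [set `|g (x + h)%R / g x - 1|%E | h in [set h : V | N h < r]])
      @ at_infinity N --> 0%E.

Definition st_flattening (R : realType) (d : nat)
    (g : 'rV[R]_d -> R -> \bar R) : Prop :=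
  flattening (@st_norm R d) (fun x => g x.1 x.2).

Definition space_flattening (R : realType) (d : nat)
    (g : 'rV[R]_d -> \bar R) : Prop :=
  flattening (@enorm R d) g.

(* Lebesgue measure on R^d, obtained by iterating the product measure; R^d is
   represented here by d.-tuple R, which carries the product sigma-algebra. *)
Section lebesgue_tuple_step.
Context (R : realType) (d : nat).
Variable m : {sigma_finite_measure set (d.-tuple R) -> \bar R}.

Definition cons_pair (x : R * d.-tuple R) : d.+1.-tuple R :=
  [the d.+1.-tuple R of x.1 :: x.2].

Definition uncons_pair (t : d.+1.-tuple R) : R * d.-tuple R :=
  (thead t, [tuple of behead t]).

Lemma cons_pairK : cancel cons_pair uncons_pair.
Proof.
move=> [x t]; rewrite /uncons_pair /cons_pair; congr pair; exact: val_inj.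
Qed.

Lemma measurable_cons_pair : measurable_fun setT cons_pair.
Proof.
by apply: measurable_cons; [exact: measurable_fst | exact: measurable_snd].
Qed.

Lemma measurable_uncons_pair : measurable_fun setT uncons_pair.
Proof.
apply: measurable_fun_pair; first exact: measurable_tnth.
exact: measurable_behead.
Qed.

Definition lebesgue_tuple_step : set (d.+1.-tuple R) -> \bar R :=
  pushforward (@lebesgue_measure R \x m)%E cons_pair.

Let step0 : lebesgue_tuple_step set0 = 0%E.
Proof. by rewrite /lebesgue_tuple_step /pushforward preimage_set0 measure0. Qed.

Let step_ge0 A : (0 <= lebesgue_tuple_step A)%E.
Proof. exact: (@measure_ge0 _ _ _ (@lebesgue_measure R \x m)%E). Qed.

Let step_sigma_additive : semi_sigma_additive lebesgue_tuple_step.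
Proof.
have mpre A : measurable A -> measurable (cons_pair @^-1` A).
  by move=> mA; rewrite -[X in measurable X]setTI; exact: measurable_cons_pair.
move=> F mF tF mUF; rewrite /lebesgue_tuple_step /pushforward preimage_bigcup.
apply: measure_semi_sigma_additive.
- by move=> n; exact: mpre.
- apply/trivIsetP => /= i j _ _ ij; rewrite -preimage_setI.
  by move/trivIsetP : tF => /(_ _ _ _ _ ij) ->//; rewrite preimage_set0.
- by rewrite -preimage_bigcup; exact: mpre.
Qed.

HB.instance Definition _ := isMeasure.Build _ _ _
  lebesgue_tuple_step step0 step_ge0 step_sigma_additive.

Let step_sigma_finite : sigma_finite setT lebesgue_tuple_step.
Proof.
have /sigma_finiteP[F [TF ndF Foo]] :=
  sigma_finiteT [the {sigma_finite_measure set (measurableTypeR R) -> \bar R} of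
                   @lebesgue_measure R].
have /sigma_finiteP[G [TG ndG Goo]] := sigma_finiteT m.
exists (fun n => uncons_pair @^-1` (F n `*` G n)).
  rewrite -preimage_bigcup -(preimage_setT uncons_pair); congr (_ @^-1` _).
  rewrite -setXTT TF TG; apply/seteqP; split => [[x y]|[x y] [n _ []]] /=.
    move=> [[n _ Fnx] [k _ Gky]]; exists (maxn n k) => //; split => /=.
    - by move: x Fnx; exact/subsetPset/ndF/leq_maxl.
    - by move: y Gky; exact/subsetPset/ndG/leq_maxr.
  by move=> ? ?; split; exists n.
move=> k; have [mF Fk] := Foo k; have [mG Gk] := Goo k; split.
  rewrite -[X in measurable X]setTI; apply: measurable_uncons_pair => //.
  exact: measurableX.
rewrite /lebesgue_tuple_step /pushforward -comp_preimage.
rewrite (_ : _ \o _ = id); last by apply/funext => x /=; exact: cons_pairK.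
rewrite preimage_id product_measure1E// lte_mul_pinfty// ge0_fin_numE//.
Qed.

HB.instance Definition _ := Measure_isSigmaFinite.Build _ _ _
  lebesgue_tuple_step step_sigma_finite.

End lebesgue_tuple_step.

Fixpoint lebesgue_tuple (R : realType) (d : nat) :
    {sigma_finite_measure set (d.-tuple R) -> \bar R} :=
  match d with
  | 0 => [the {sigma_finite_measure set (0.-tuple R) -> \bar R} of
            \d_([tuple] : 0.-tuple R)]
  | d'.+1 => [the {sigma_finite_measure set (d'.+1.-tuple R) -> \bar R} of
            lebesgue_tuple_step (lebesgue_tuple R d')]
  end.

Definition row_of_tuple (R : realType) (d : nat) (t : d.-tuple R) : 'rV[R]_d :=
  \row_i tnth t i.

Definition dotr (R : realType) (d : nat) (u v : 'rV[R]_d) : R :=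
  \sum_(i < d) u ord0 i * v ord0 i.

(* K, as a function of the lag (s, t), is the covariance function of a
   real-valued random field on R^d x R with finite second moments. *)
Definition stationary_covariance (R : realType) (d : nat)
    (K : 'rV[R]_d -> R -> R) : Prop :=
  exists (dO : measure_display) (Omega : measurableType dO)
    (P : probability Omega R) (Z : 'rV[R]_d -> R -> Omega -> R),
    (forall s t, Z s t \in Lfun P 2%:E) /\
    (forall s t s' t',
       covariance P (Z s t) (Z s' t') = (K (s - s') (t - t'))%:E).

(* In the last condition the integrand is split into its real and imaginary
   parts, exp (i x) = cos x + i sin x; both iterated integrals are finite since
   g is integrable. *)
Definition is_spectral_density (R : realType) (d : nat)
    (K : 'rV[R]_d -> R -> R) (g : 'rV[R]_d -> R -> \bar R) : Prop :=
  [/\ (forall l w, (0 <= g l w)%E),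
      (lebesgue_tuple R d \x @lebesgue_measure R)%E.-integrable setT
        (fun x => g (row_of_tuple x.1) x.2) &
      forall (s : 'rV[R]_d) (t : R),
        let part (f : R -> R) :=
          fine (\int[@lebesgue_measure R]_w \int[lebesgue_tuple R d]_l
            (g (row_of_tuple l) w *
             (f (dotr s (row_of_tuple l) + t * w))%:E))%E in
        ((K s t)%:C)%C =
          (((2 * pi) ^+ d.+1)^-1%:C * (part cos +i* part sin))%C].

(* Main.v *)
Require Import Defs.
From mathcomp Require Import all_boot all_order all_algebra.
From mathcomp Require Import all_classical all_reals all_analysis.
From mathcomp Require Import ring.

Set Implicit Arguments.
Unset Strict Implicit.
Unset Printing Implicit Defensive.

Import Order.TTheory GRing.Theory Num.Theory.
Import numFieldNormedType.Exports.

Local Open Scope classical_set_scope.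
Local Open Scope ring_scope.

(** For (i), shifting [(l, w)] to [(l, w')] is a bounded displacement, so as
[l] tends to infinity both [g l w' / g l w] and [q l w' / q l w] tend to 1,
while their quotient is the constant [p w' / p w].  For (ii), the
displacements [(v, 0)] of the points [(l, w0)] are among those that the
flattening condition on [g] controls. *)

Global Instance at_infinity_filter (R : realType) (V : Type) (N : V -> R) :
  Filter (at_infinity N).
Proof.
apply: filter_from_filter; first by exists 0.
move=> i j _ _; exists (Num.max i j) => // x /=.
by rewrite gt_max => /andP[].
Qed.

Section flattening_epsilon.
Context (R : realType) (V : zmodType) (N : V -> R) (g : V -> \bar R).

(** The set of extended reals below [e] is a neighbourhood of 0, and each quotient is at most the
    supremum. *)
Lemma flattening_lt (r e : R) : flattening N g -> 0 < r -> 0 < e ->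
  exists M, forall x h, M < N x -> N h < r ->
    (`|g (x + h)%R / g x - 1| < e%:E)%E.
Proof.
move=> fg r0 e0.
have e0' : (0 < e%:E)%E by rewrite lte_fin.
have [M _ MP] := fg r r0 _ (open_ereal_lt' e0').
exists M => x h Mx hr; apply: le_lt_trans (MP x Mx).
by apply: ereal_sup_ubound; exists h.
Qed.

(** [N 0 = 0] puts the zero displacement in every ball, so the supremum is over a nonempty set and
    cannot be [-oo]. It then lies between 0 and [e], hence is finite, and the limit reduces to one
    of reals. *)
Lemma flatteningI : N 0 = 0 ->
  (forall r e : R, 0 < r -> 0 < e -> exists M, forall x h, M < N x -> N h < r ->
    (`|g (x + h)%R / g x - 1| < e%:E)%E) ->
  flattening N g.
Proof.
move=> N0 H r r0.
set S := fun x => ereal_sup _.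
have S_ge0 x : (0 <= S x)%E.
  apply: (@le_trans _ _ `|g (x + 0)%R / g x - 1|%E); first exact: abse_ge0.
  by apply: ereal_sup_ubound; exists 0 => //=; rewrite N0.
have S_le e : 0 < e -> \forall x \near at_infinity N, (S x <= e%:E)%E.
  move=> e0; have [M MP] := H r e r0 e0; exists M => // x Mx.
  by apply: ge_ereal_sup => _ [h hr <-]; exact/ltW/MP.
have S_fin x e : (S x <= e%:E)%E -> S x \is a fin_num.
  by move=> Sx; rewrite ge0_fin_numE// (le_lt_trans Sx)// ltry.
apply/fine_cvgP; split.
  by apply: filterS (S_le 1 ltr01) => x; exact: S_fin.
apply/cvgr0Pnorm_le => e e0; apply: filterS (S_le e e0) => x Sx /=.
by rewrite ger0_norm ?fine_ge0// -lee_fin fineK ?(S_fin x e).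
Qed.

End flattening_epsilon.

(** Under the conventions of [\bar R], [y / y] is 0 for [y] equal to 0 or [+oo], and [+oo] for
    [y = -oo]. Applied to the zero displacement, this makes a flattening function finite and nonzero
    far out. *)
Lemma abse_div_self_lt1 (R : realType) (y : \bar R) :
  (`|y / y - 1| < 1)%E -> y \is a fin_num /\ y != 0%E.
Proof.
case: y => [y| |].
- case: (eqVneq y 0) => [->|y0 _]; last by rewrite eqe y0.
  by rewrite mul0e sub0e abseN abse1 ltxx.
- by rewrite invey mule0 sub0e abseN abse1 ltxx.
- by rewrite inveNy mulNyNy.
Qed.

Lemma enorm0 (R : realType) (d : nat) : enorm (0 : 'rV[R]_d) = 0.
Proof.
by rewrite /enorm big1 ?sqrtr0// => i _; rewrite mxE expr0n.
Qed.

Lemma st_norm0 (R : realType) (d : nat) (w : R) :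
  st_norm (0 : 'rV[R]_d, w) = `|w|.
Proof.
rewrite /st_norm/= big1 ?add0r ?sqrtr_sqr// => i _.
by rewrite mxE expr0n.
Qed.

Lemma st_norm_space (R : realType) (d : nat) (l : 'rV[R]_d) :
  st_norm (l, 0 : R) = enorm l.
Proof. by rewrite /st_norm/= expr0n/= addr0. Qed.

Lemma enorm_le_st_norm (R : realType) (d : nat) (l : 'rV[R]_d) (w : R) :
  enorm l <= st_norm (l, w).
Proof. by rewrite ler_wsqrtr//= lerDl sqr_ge0. Qed.

Lemma enorm_unbounded (R : realType) (d : nat) (M : R) : (0 < d)%N ->
  exists l : 'rV[R]_d, M < enorm l.
Proof.
(* A single coordinate already gives norm at least [|M| + 1]. *)
case: d => // d _; exists (const_mx (`|M| + 1)).
apply: (@lt_le_trans _ _ (`|M| + 1)); first by rewrite ltr_pwDr// ler_norm.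
have M0 : 0 <= `|M| + 1 by rewrite addr_ge0.
rewrite -[leLHS](ger0_norm M0) -sqrtr_sqr ler_wsqrtr//.
by rewrite big_ord_recl mxE lerDl sumr_ge0// => i _; rewrite mxE sqr_ge0.
Qed.

Section st_flattening_shift.
Context (R : realType) (d : nat) (g : 'rV[R]_d -> R -> \bar R).

Lemma st_flattening_time (w w' e : R) : st_flattening g -> 0 < e ->
  exists M, forall l, M < enorm l -> (`|g l w' / g l w - 1| < e%:E)%E.
Proof.
move=> fg e0.
(* The added 1 places the displacement [(0, w' - w)] strictly inside the ball and keeps the radius
   positive when [w' = w]. *)
have r0 : 0 < `|w' - w| + 1 by rewrite ltr_wpDl.
have [M MP] := flattening_lt fg r0 e0; exists M => l Ml.
have := MP (l, w) (0, w' - w) (lt_le_trans Ml (enorm_le_st_norm _ _)).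
by rewrite /= addr0 subrKC st_norm0 ltrDl; exact.
Qed.

Lemma st_flattening_space (w : R) :
  st_flattening g -> space_flattening (fun l => g l w).
Proof.
move=> fg; apply: flatteningI; first exact: enorm0.
move=> r e r0 e0; have [M MP] := flattening_lt fg r0 e0.
exists M => l v Ml vr.
have := MP (l, w) (v, 0) (lt_le_trans Ml (enorm_le_st_norm _ _)).
by rewrite /= addr0 st_norm_space; exact.
Qed.

End st_flattening_shift.

Lemma eq1_of_small_dist (R : realType) (c : R) :
  (forall e, 0 < e -> exists s, `|s - 1| < e /\ `|c * s - 1| < e) -> c = 1.
Proof.
move=> H; apply/eqP; rewrite -subr_eq0 -normr_le0 leNgt; apply/negP => c1.
have k0 : 0 < `|c| + 1 by rewrite ltr_wpDl.
(* With [e = |c - 1| / (|c| + 1)], the identity [c - 1 = (c * s - 1) - c * (s - 1)] yields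
   [|c - 1| < (|c| + 1) * e = |c - 1|]. *)
have [s [s1 cs1]] := H _ (divr_gt0 c1 k0).
have : `|c - 1| <= `|c| * `|s - 1| + `|c * s - 1|.
  rewrite -normrM (_ : c - 1 = (c * s - 1) - c * (s - 1)); last by ring.
  by rewrite [leRHS]addrC ler_normB.
apply/negP; rewrite -ltNge.
rewrite -[ltRHS](divfK (lt0r_neq0 k0)) mulrDr mulr1 [_ / _ * _]mulrC.
by rewrite ler_ltD// ler_wpM2l// ltW.
Qed.

Lemma flattening_factor_constant (R : realType) (d : nat)
    (g q : 'rV[R]_d -> R -> \bar R) (p : R -> \bar R) : (0 < d)%N ->
  (forall l w, g l w = (p w * q l w)%E) ->
  st_flattening g -> st_flattening q -> forall w w', p w = p w'.
Proof.
move=> d0 gpq fg fq w w'.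
(* One [l] beyond six thresholds: two for the shift from [w] to [w'], four for zero shifts, which
   make [g] and [q] finite and nonzero at both times. *)
have far e : 0 < e -> exists l,
    [/\ (`|g l w' / g l w - 1| < e%:E)%E, (`|q l w' / q l w - 1| < e%:E)%E,
        (g l w \is a fin_num /\ g l w != 0%E),
        (g l w' \is a fin_num /\ g l w' != 0%E) &
        (q l w \is a fin_num /\ q l w != 0%E) /\
        (q l w' \is a fin_num /\ q l w' != 0%E)].
  move=> e0.
  have [M1 P1] := st_flattening_time w w' fg e0.
  have [M2 P2] := st_flattening_time w w' fq e0.
  have [M3 P3] := st_flattening_time w w fg ltr01.
  have [M4 P4] := st_flattening_time w' w' fg ltr01.
  have [M5 P5] := st_flattening_time w w fq ltr01.
  have [M6 P6] := st_flattening_time w' w' fq ltr01.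
  have [l] := enorm_unbounded
    (Num.max M1 (Num.max M2 (Num.max M3 (Num.max M4 (Num.max M5 M6))))) d0.
  rewrite !gt_max => /and5P[l1 l2 l3 l4 /andP[l5 l6]].
  exists l; split; [exact: P1|exact: P2|exact/abse_div_self_lt1/P3|
    exact/abse_div_self_lt1/P4|].
  by split; [exact/abse_div_self_lt1/P5|exact/abse_div_self_lt1/P6].
(* An infinite [a] times a finite nonzero [x] is infinite; this is how [p] is shown to be finite and
   nonzero at [w] and [w']. *)
have fin_factor (a x : \bar R) : x \is a fin_num -> x != 0%E ->
    (a * x)%E \is a fin_num -> (a * x != 0)%E -> exists2 b, a = b%:E & b != 0.
  case: x => // x _; rewrite eqe => x0; case: a => [a||].
  - by rewrite eqe mulf_eq0 negb_or => _ /andP[a0 _]; exists a.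
  - move: x0; rewrite neq_lt => /orP[] x0.
      by rewrite lt0_mulye ?lte_fin.
    by rewrite gt0_mulye ?lte_fin.
  - move: x0; rewrite neq_lt => /orP[] x0.
      by rewrite lt0_mulNye ?lte_fin.
    by rewrite gt0_mulNye ?lte_fin.
have [l [_ _ gw gw' [qw qw']]] := far 1 ltr01.
have [a pa a0] : exists2 a, p w = a%:E & a != 0.
  by move: gw; rewrite gpq => -[]; apply: fin_factor; case: qw.
have [b pb b0] : exists2 b, p w' = b%:E & b != 0.
  by move: gw'; rewrite gpq => -[]; apply: fin_factor; case: qw'.
(* The goal [a = b] becomes [b / a = 1]. *)
rewrite pa pb; congr EFin; apply/esym/eqP.
rewrite -(inj_eq (mulIf (invr_neq0 a0))) divff//; apply/eqP.
apply: eq1_of_small_dist => e e0.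
have {l gw gw' qw qw'} [l [+ + _ _ [[+ +] [+ _]]]] := far e e0.
rewrite !gpq pa pb.
case: (q l w) => // x; case: (q l w') => // y; rewrite eqe => + + _ x0 _.
rewrite -!EFinM !inver mulf_eq0 (negbTE a0) (negbTE x0)/= !lte_fin => g1 q1.
(* Here [y / x] is the quotient of [q], and [b / a] times it is the quotient of [g]; both are within
   [e] of 1. *)
exists (y / x); split => //.
by rewrite (_ : _ * _ = b * y / (a * x))//; field; rewrite a0 x0.
Qed.

Theorem mainTheorem2 (R : realType) (d : nat) (d_gt0 : (0 < d)%N)
  (K : 'rV[R]_d -> R -> R)
  (K_cov : stationary_covariance K)
  (K_cont : continuous (fun x : 'rV[R]_d * R => K x.1 x.2))
  (g q : 'rV[R]_d -> R -> \bar R) (p : R -> \bar R)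
  (g_density : is_spectral_density K g)
  (g_pq : forall l w, g l w = (p w * q l w)%E) :
  (st_flattening g -> st_flattening q -> exists c, forall w, p w = c) /\
  (st_flattening g ->
   forall w0, (0 < p w0 < +oo)%E -> space_flattening (fun l => g l w0)).
Proof.
split=> [fg fq|fg w0 _]; last exact: st_flattening_space.
exists (p 0) => w; exact: (flattening_factor_constant d_gt0 g_pq fg fq).
Qed.
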